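(* Fix any $\theta\in(0,1]$ and consider the distribution $\pi=\pi_\theta$ on $\mathcal{X}=\{0,1\}^n$ defined by $\pi(x)=\theta^{S(x)}(1+\theta)^{-n}$. Then the lazy$(1/2)$ random walk Metropolis algorithm for $\pi$ follows the same law as the lazy$\big((1-\theta)/2\big)$ Gibbs sampler for $\pi$ (that is, the two Markov chains have the same transition probability matrix).
   Context: For $x\in\{0,1\}^n$, $S(x)=\sum_{i=1}^n x_i$. Two states are neighbors if they differ in exactly one coordinate. (Non-lazy) random walk Metropolis algorithm for $\pi$: from state $x$, choose one of the $n$ neighbors $y$ of $x$ uniformly at random, move to $y$ with probability $\min(1,\pi(y)/\pi(x))$, and otherwise stay at $x$. Let $\mathbb{P}$ be its transition matrix. (Non-lazy, random scan) Gibbs sampler for $\pi$: from state $x$, draw a coordinate $i\in\{1,\dots,n\}$ uniformly at random, leave all coordinates $j\ne i$ unchanged, and replace coordinate $i$ by a draw from the conditional distribution under $\pi$ of coordinate $i$ given the values of $x$ at all coordinates $j\neq i$. Let $\mathbb{Q}$ be its transition matrix. For $q\in[0,1]$, the lazy$(q)$ random walk Metropolis algorithm for $\pi$ is the Markov chain with transition matrix $(1-q)\mathbb{P}+qI$, and the lazy$(q)$ Gibbs sampler for $\pi$ is the Markov chain with transition matrix $(1-q)\mathbb{Q}+qI$, where $I$ is the identity matrix. *)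

(* Defs.v *)
From HB Require Import structures.
From mathcomp Require Import all_boot all_order all_algebra.
Set Implicit Arguments.
Unset Strict Implicit.
Unset Printing Implicit Defensive.
Import Order.TTheory GRing.Theory Num.Theory.
Local Open Scope ring_scope.

Definition state (n : nat) := {ffun 'I_n -> bool}.

Definition coord_sum (n : nat) (x : state n) : nat := (\sum_(i < n) x i)%N.

Definition neighbors (n : nat) (x : state n) : {set state n} :=
  [set y : state n | #|[set i | x i != y i]| == 1%N].

(* Matrices on {0,1}^n are indexed by the enumeration of the states: row s and
   column t correspond to the states enum_val s and enum_val t. *)
Definition transition_mx (R : realFieldType) (n : nat)
    (K : state n -> state n -> R) : 'M[R]_#|{: state n}| :=
  \matrix_(s, t) K (enum_val s) (enum_val t).

Definition accept (R : realFieldType) (n : nat) (pi : state n -> R)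
    (x z : state n) : R :=
  Num.min 1 (pi z / pi x).

(* The sum ranges over the proposal z, drawn uniformly among the neighbors of
   x; the two terms are acceptance (move to z) and rejection (stay at x). *)
Definition metropolis (R : realFieldType) (n : nat) (pi : state n -> R)
    : 'M[R]_#|{: state n}| :=
  transition_mx (fun x y =>
    \sum_(z in neighbors x) #|neighbors x|%:R^-1 *
      (accept pi x z * (y == z)%:R + (1 - accept pi x z) * (y == x)%:R)).

Definition agree_off (n : nat) (i : 'I_n) (x : state n) : {set state n} :=
  [set z : state n | [forall j, (j != i) ==> (z j == x j)]].

(* pi(z_i = b | z_j = x_j for all j != i) *)
Definition cond_coord (R : realFieldType) (n : nat) (pi : state n -> R)
    (i : 'I_n) (x : state n) (b : bool) : R :=
  (\sum_(z in agree_off i x | z i == b) pi z) / (\sum_(z in agree_off i x) pi z).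

Definition set_coord (n : nat) (x : state n) (i : 'I_n) (b : bool) : state n :=
  [ffun j => if j == i then b else x j].

(* The outer sum ranges over the coordinate i drawn uniformly, the inner one
   over its new value b. *)
Definition gibbs (R : realFieldType) (n : nat) (pi : state n -> R)
    : 'M[R]_#|{: state n}| :=
  transition_mx (fun x y =>
    \sum_(i < n) n%:R^-1 *
      \sum_(b : bool) cond_coord pi i x b * (y == set_coord x i b)%:R).

Definition lazy_mx (R : realFieldType) (m : nat) (q : R) (P : 'M[R]_m) : 'M[R]_m :=
  (1 - q) *: P + q%:M.

Definition pi_theta (R : realFieldType) (n : nat) (theta : R) (x : state n) : R :=
  theta ^+ coord_sum x * (1 + theta) ^- n.

(* Main.v *)
Require Import Defs.
From mathcomp Require Import all_boot all_order all_algebra ring lra.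
Set Implicit Arguments.
Unset Strict Implicit.
Unset Printing Implicit Defensive.
Import Order.TTheory GRing.Theory Num.Theory.
Local Open Scope ring_scope.

(** Both chains pick a uniform coordinate [i] and then either flip it or stay
    put, so each kernel has the form
      [P x y = 1_{y = x} + n^-1 * \sum_i p i * (1_{y = flip x i} - 1_{y = x})],
    where [p i] is the probability of carrying out the flip of [i]
    ([metropolis_flipE], [gibbs_flipE]).  Making such a chain lazy only rescales
    every [p i] by [1 - q].  For [pi_theta] a coordinate equal to 1 weighs
    [theta] times a coordinate equal to 0, independently of the others.  As
    [theta <= 1], Metropolis flips a 1 with probability 1 and a 0 with
    probability [theta] ([accept_pi_theta]), while Gibbs flips them with
    probabilities [1 / (1 + theta)] and [theta / (1 + theta)]
    ([cond_coord_pi_theta]).  The Metropolis probabilities are thus [1 + theta]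
    times the Gibbs ones, which is exactly the ratio of the two moving
    probabilities [1 - (1 - theta) / 2 = (1 + theta) / 2] and [1 / 2]. *)

Definition flip (n : nat) (x : state n) (i : 'I_n) : state n :=
  set_coord x i (~~ x i).

(** Written as a perturbation of the identity kernel, so that mixing with the
    identity acts on [p] alone. *)
Definition flip_kernel (R : realFieldType) (n : nat) (p : state n -> 'I_n -> R)
    (x y : state n) : R :=
  (y == x)%:R + n%:R^-1 * \sum_(i < n) p x i * ((y == flip x i)%:R - (y == x)%:R).

Lemma set_coord_id (n : nat) (x : state n) (i : 'I_n) : set_coord x i (x i) = x.
Proof. by apply/ffunP=> j; rewrite ffunE; case: eqP => [->|]. Qed.

Lemma set_coord_at (n : nat) (x : state n) (i : 'I_n) b : set_coord x i b i = b.
Proof. by rewrite ffunE eqxx. Qed.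

Lemma set_coord_inj (n : nat) (x : state n) (i : 'I_n) : injective (set_coord x i).
Proof. by move=> b c /(congr1 (fun z : state n => z i)); rewrite !set_coord_at. Qed.

Lemma diff_flip (n : nat) (x : state n) (i : 'I_n) :
  [set j | x j != flip x i j] = [set i].
Proof.
apply/setP=> j; rewrite !inE ffunE.
by case: (j =P i) => [->|_]; [case: (x i) | rewrite eqxx].
Qed.

Lemma flip_inj (n : nat) (x : state n) : injective (flip x).
Proof. by move=> i j eq_ij; apply: set1_inj; rewrite -!(diff_flip x) eq_ij. Qed.

Lemma neighborsE (n : nat) (x : state n) : neighbors x = [set flip x i | i in 'I_n].
Proof.
apply/setP=> y; rewrite inE; apply/cards1P/imsetP => [[i def_i]|[i _ ->]].
  exists i => //; apply/ffunP=> j; rewrite ffunE.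
  move/setP/(_ j): def_i; rewrite !inE; case: (j =P i) => [->|_].
    by case: (x i); case: (y i).
  by move/negbFE/eqP.
by exists i; rewrite diff_flip.
Qed.

Lemma agree_offE (n : nat) (i : 'I_n) (x : state n) :
  agree_off i x = [set set_coord x i b | b in {: bool}].
Proof.
apply/setP=> z; rewrite inE; apply/forallP/imsetP => [agr|[b _ ->] j].
  exists (z i) => //; apply/ffunP=> j; rewrite ffunE.
  by case: eqP => [->|/eqP ne]; last exact/eqP/(implyP (agr j)).
by apply/implyP=> /negPf ne; rewrite ffunE ne.
Qed.

Lemma cond_coordE (R : realFieldType) (n : nat) (pi : state n -> R)
    (i : 'I_n) (x : state n) (b : bool) :
  cond_coord pi i x b =
    pi (set_coord x i b) / (pi (set_coord x i true) + pi (set_coord x i false)).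
Proof.
have injS : {in {: bool} &, injective (set_coord x i)}.
  by move=> ? ? _ _; apply: set_coord_inj.
rewrite /cond_coord agree_offE big_mkcondr /= !big_imset //= !big_bool.
by rewrite !set_coord_at; case: b; rewrite /= ?addr0 ?add0r.
Qed.

Lemma mean_const (R : realFieldType) (n : nat) (c : R) :
  (0 < n)%N -> n%:R^-1 * \sum_(i < n) c = c.
Proof.
move=> n_gt0; rewrite sumr_const card_ord -[c *+ n]mulr_natl mulKf //.
by rewrite pnatr_eq0 -lt0n.
Qed.

Lemma metropolis_flipE (R : realFieldType) (n : nat) (pi : state n -> R) :
  (0 < n)%N ->
  metropolis pi = transition_mx (flip_kernel (fun x i => accept pi x (flip x i))).
Proof.
move=> n_gt0; apply/matrixP=> s t; rewrite !mxE.
move: (enum_val s) (enum_val t) => x y.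
have injF : {in 'I_n &, injective (flip x)} by move=> ? ? _ _; apply: flip_inj.
rewrite neighborsE card_imset; last exact: flip_inj.
rewrite card_ord big_imset //= -big_distrr /= /flip_kernel.
(* The indicator of staying put is averaged over the n proposals. *)
rewrite -[X in _ = X + _](mean_const _ n_gt0) -mulrDr -big_split /=.
congr (_ * _); apply: eq_bigr => i _.
ring.
Qed.

(** Redrawing the current value [x i] is staying put.  Its probability is the
    complement of that of a flip because [pi] has positive mass on
    [agree_off i x], so that the conditional law at [i] has total mass 1. *)
Lemma gibbs_flipE (R : realFieldType) (n : nat) (pi : state n -> R) :
  (0 < n)%N -> (forall x, 0 < pi x) ->
  gibbs pi = transition_mx (flip_kernel (fun x i => cond_coord pi i x (~~ x i))).
Proof.
move=> n_gt0 pi_gt0; apply/matrixP=> s t; rewrite !mxE.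
move: (enum_val s) (enum_val t) => x y.
rewrite -big_distrr /= /flip_kernel.
rewrite -[X in _ = X + _](mean_const _ n_gt0) -mulrDr -big_split /=.
congr (_ * _); apply: eq_bigr => i _.
have cond_sum1 : cond_coord pi i x (x i) = 1 - cond_coord pi i x (~~ x i).
  rewrite !cond_coordE; have := pi_gt0 (set_coord x i true).
  have := pi_gt0 (set_coord x i false); case: (x i) => /= ? ?; field; lra.
have -> : \sum_b cond_coord pi i x b * (y == set_coord x i b)%:R =
    cond_coord pi i x (x i) * (y == set_coord x i (x i))%:R +
    cond_coord pi i x (~~ x i) * (y == flip x i)%:R.
  by rewrite /flip big_bool /=; case: (x i) => //=; rewrite addrC.
rewrite set_coord_id cond_sum1; ring.
Qed.

(** A kernel [flip_kernel p] is affine in [p] and is the identity at [p = 0]. *)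
Lemma lazy_flip_kernel (R : realFieldType) (n : nat) (q : R)
    (p : state n -> 'I_n -> R) :
  lazy_mx q (transition_mx (flip_kernel p)) =
  transition_mx (flip_kernel (fun x i => (1 - q) * p x i)).
Proof.
apply/matrixP=> s t; rewrite !mxE -mulr_natr.
have -> : (s == t) = (enum_val t == enum_val s).
  by rewrite (inj_eq enum_val_inj) eq_sym.
rewrite /flip_kernel.
under [in RHS]eq_bigr => i _ do rewrite -mulrA.
rewrite -big_distrr /=; ring.
Qed.

Lemma pi_theta_gt0 (R : realFieldType) (n : nat) (theta : R) (x : state n) :
  0 < theta -> 0 < pi_theta theta x.
Proof.
by move=> th; rewrite /pi_theta mulr_gt0 ?invr_gt0 ?exprn_gt0 ?addr_gt0.
Qed.

Lemma pi_theta_set_coord (R : realFieldType) (n : nat) (theta : R)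
    (x : state n) (i : 'I_n) :
  pi_theta theta (set_coord x i true) =
  theta * pi_theta theta (set_coord x i false).
Proof.
rewrite /pi_theta mulrA -exprS; congr (theta ^+ _ * _).
rewrite /coord_sum (bigD1 i) // [in RHS](bigD1 i) //= !set_coord_at add1n add0n.
by congr _.+1; apply: eq_bigr => j /negPf ne; rewrite !ffunE ne.
Qed.

(** Flipping a 1 multiplies [pi_theta] by [theta^-1 >= 1], so it is always
    accepted. *)
Lemma accept_pi_theta (R : realFieldType) (n : nat) (theta : R)
    (x : state n) (i : 'I_n) :
  0 < theta -> theta <= 1 ->
  accept (@pi_theta R n theta) x (flip x i) = theta ^+ ~~ x i.
Proof.
move=> th_gt0 th_le1; rewrite /accept -[in X in _ / X](set_coord_id x i) /flip.
have pi0 := @pi_theta_gt0 R n theta (set_coord x i false) th_gt0.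
case: (x i); rewrite /= pi_theta_set_coord.
  rewrite invfM mulrCA divff ?gt_eqF // mulr1 expr0.
  by apply/min_idPl; rewrite invf_ge1.
by rewrite mulfK ?gt_eqF // expr1; apply/min_idPr.
Qed.

Lemma cond_coord_pi_theta (R : realFieldType) (n : nat) (theta : R)
    (x : state n) (i : 'I_n) (b : bool) :
  0 < theta -> cond_coord (@pi_theta R n theta) i x b = theta ^+ b / (1 + theta).
Proof.
move=> th_gt0; rewrite cond_coordE pi_theta_set_coord.
have pi0 := @pi_theta_gt0 R n theta (set_coord x i false) th_gt0.
set w := pi_theta theta (set_coord x i false) in pi0 *.
have -> : pi_theta theta (set_coord x i b) = theta ^+ b * w.
  by case: b; rewrite ?pi_theta_set_coord ?expr1 ?expr0 ?mul1r.
have -> : theta * w + w = (1 + theta) * w by ring.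
by rewrite -mulf_div divff ?mulr1 // gt_eqF.
Qed.

Theorem proposition19 (R : realFieldType) (n : nat) (theta : R)
    (n_gt0 : (0 < n)%N) (theta_gt0 : 0 < theta) (theta_le1 : theta <= 1) :
  lazy_mx (1 / 2%:R) (metropolis (@pi_theta R n theta)) =
  lazy_mx ((1 - theta) / 2%:R) (gibbs (@pi_theta R n theta)).
Proof.
rewrite metropolis_flipE // gibbs_flipE //; last by move=> x; apply: pi_theta_gt0.
rewrite !lazy_flip_kernel; apply/matrixP=> s t; rewrite !mxE /flip_kernel.
congr (_ + _ * _); apply: eq_bigr => i _; congr (_ * _).
rewrite accept_pi_theta // cond_coord_pi_theta //.
move: (theta ^+ _) => a; field; lra.
Qed.
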